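(* Let $f$ satisfy $(\mathcal A)$ and let $p\ge1$. Let $y_{-1},y_0\in\mathcal H$ with $y_0\neq y_{-1}$, and define recursively for $k\ge0$ $$\lambda_k=\|y_k-y_{k-1}\|^{-\frac{p-1}{p}},\qquad y_{k+1}=\operatorname{prox}_{\lambda_k f}(y_k),$$ and assume $\nabla f(y_k)\neq0$ for all $k\ge0$ (so the iteration never stops and all $\lambda_k$ are well defined). Then $f(y_k)-\inf_{\mathcal H}f=o\big(k^{-(2-\frac1p)}\big)$ as $k\to+\infty$, and $(y_k)_{k\ge0}$ converges weakly to an element of $S=\operatorname{argmin} f$.
   Context: $\mathcal H$ is a real Hilbert space. Assumption $(\mathcal A)$: $f:\mathcal H\to\mathbb R$ is convex and continuously differentiable, $S=\operatorname{argmin}_{\mathcal H} f\neq\emptyset$, and $\nabla f$ is Lipschitz continuous on bounded subsets of $\mathcal H$. For $\lambda>0$, $\operatorname{prox}_{\lambda f}(y)=\operatorname{argmin}_{u\in\mathcal H}\{f(u)+\frac{1}{2\lambda}\|u-y\|^2\}$. *)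

(* Defs.v *)
From HB Require Import structures.
From mathcomp Require Import all_boot all_order all_algebra.
From mathcomp Require Import all_classical all_reals all_analysis.
Set Implicit Arguments. Unset Strict Implicit. Unset Printing Implicit Defensive.
Import Order.TTheory GRing.Theory Num.Theory.
Import numFieldNormedType.Exports.
Local Open Scope ring_scope.
Local Open Scope classical_set_scope.

Definition hilbert_inner (R : realType) (V : completeNormedModType R)
  (inner : V -> V -> R) : Prop :=
  [/\ (forall x y, inner x y = inner y x),
      (forall x y z, inner (x + y) z = inner x z + inner y z),
      (forall (a : R) x y, inner (a *: x) y = a * inner x y)
    & (forall x, `|x| ^+ 2 = inner x x)].

Definition convex_fun (R : realType) (V : normedModType R) (f : V -> R) : Prop :=
  forall (x y : V) (t : R), 0 <= t <= 1 ->
    f (t *: x + (1 - t) *: y) <= t * f x + (1 - t) * f y.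

Definition is_gradient (R : realType) (V : normedModType R)
  (inner : V -> V -> R) (f : V -> R) (g : V -> V) : Prop :=
  forall x, differentiable f x /\ forall h, 'd f x h = inner (g x) h.

Definition lipschitz_on_bounded (R : realType) (V : normedModType R)
  (g : V -> V) : Prop :=
  forall M : R, exists L : R, forall x y : V, `|x| <= M -> `|y| <= M ->
    `|g x - g y| <= L * `|x - y|.

Definition is_argmin (R : realType) (V : normedModType R) (f : V -> R) (x : V) :=
  forall u, f x <= f u.

Definition is_prox (R : realType) (V : normedModType R) (lam : R) (f : V -> R)
  (y u : V) : Prop :=
  forall v, f u + (2 * lam)^-1 * `|u - y| ^+ 2 <= f v + (2 * lam)^-1 * `|v - y| ^+ 2.

(* Main.v *)
Require Import Defs.
From HB Require Import structures.
From mathcomp Require Import all_boot all_order all_algebra.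
From mathcomp Require Import all_classical all_reals all_analysis.
From mathcomp Require Import ring lra zify.
Set Implicit Arguments. Unset Strict Implicit. Unset Printing Implicit Defensive.
Import Order.TTheory GRing.Theory Num.Theory.
Import numFieldNormedType.Exports.
Local Open Scope ring_scope.
Local Open Scope classical_set_scope.

(* Let s_n be the sum of the first n step sizes and g_n the gradient norm at
   y_n.  For any proximal point iteration and any minimiser x,
   2 s_n (f(y_n) - min f) + |y_n - x|^2 + s_n^2 g_n^2 is nonincreasing, so
   g_n <= D/s_n for a constant D.  With r = 2 - 1/p the feedback law reads
   lambda_{k+1} = (lambda_k g_{k+1})^(1-r), whence
   lambda_{k+1} lambda_k^(r-1) >= (s_{k+1}/D)^(r-1), a difference inequality
   that forces s_n >= (c n)^r.  As f(y_n) decreases and the sum of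
   lambda_k (f(y_{k+1}) - min f) is finite, f(y_n) - min f = o(1/s_n).
   Weak convergence is Opial's argument: distances to minimisers are
   nonincreasing and weak cluster points are minimisers. *)

Lemma filter_ultraP {T : Type} (F : set_system T) (A : set T) : Filter F ->
  F A <-> (forall G, UltraFilter G -> F `<=` G -> G A).
Proof.
move=> FF; split=> [FA G _|GA]; first exact.
apply: contrapT => nFA.
have properFnA : ProperFilter (within (~` A) F).
  split; last exact: within_filter.
  by rewrite /within /= => F0; apply: nFA; apply: filterS F0 => t /contrapT.
have [G [ultraG FG]] := ultraFilterLemma properFnA.
have GnA : G (~` A) by apply: FG; exact: nearW.
have GAt : G A by apply: GA => B FB; apply: FG; apply: filterS FB.
by have [t []] := filter_ex (filterI GAt GnA).
Qed.

Lemma bounded_ultra_cvg {R : realType} {T : Type} (U : set_system T)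
    (u : T -> R) (M : R) :
  UltraFilter U -> (forall t, `|u t| <= M) -> cvg (u @ U).
Proof.
move=> UU uM.
have uI t : `[- M, M]%classic (u t) by rewrite /= in_itv /= -ler_norml.
have [|l [_ cl]] := @segment_compact R (- M) M (u @ U) _ _.
  exact: (@filterE _ U _ (u @^-1` `[- M, M]%classic) uI).
apply/cvg_ex; exists l => B Bl; rewrite /nbhs /=.
have [//|UnB] := in_ultra_setVsetC (u @^-1` B) UU.
by have [r [nBr Br]] := cl (~` B) B UnB Bl.
Qed.

Lemma inf_cvg_seq {R : realType} (E : set R) : has_inf E ->
  exists2 u : R^nat, (forall n, E (u n)) & u @ \oo --> inf E.
Proof.
move=> infE.
have /choice[u uP] n : exists x, E x /\ x < inf E + n.+1%:R^-1.
  have n1_gt0 : 0 < (n.+1%:R^-1 : R) by rewrite invr_gt0.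
  by have [x Ex xlt] := inf_adherent n1_gt0 infE; exists x.
exists u => [n|]; first by have [] := uP n.
apply: (@squeeze_cvgr _ _ _ _ (cst (inf E)) (fun n => inf E + n.+1%:R^-1)).
- apply: nearW => n; have [Eun /ltW ->] := uP n.
  by rewrite andbT ge_inf //; case: infE.
- exact: cvg_cst.
- rewrite -[X in _ --> X]addr0.
  by apply: cvgD; [exact: cvg_cst|exact: cvg_harmonic].
Qed.

Section Minimisers.
Context {R : realType}.

Lemma inf_range_argmin {V : normedModType R} (F : V -> R) x :
  is_argmin F x -> inf (range F) = F x.
Proof.
move=> Fmin; apply/eqP; rewrite eq_le; apply/andP; split.
  by apply: ge_inf; [exists (F x) => _ [u _ <-]|exists x].
by apply: lb_le_inf => [|_ [u _ <-]] //; exists (F x), x.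
Qed.

Lemma is_derive_cvg_at_right {V : normedModType R} (F : V -> R) x h d :
  is_derive x h F d -> t^-1 * (F (t *: h + x) - F x) @[t --> 0^'+] --> d.
Proof. by case=> Fxh <-; exact: cvg_dnbhs_at_right. Qed.

Lemma is_derive_argmin_eq0 {V : normedModType R} (F : V -> R) x h d :
  is_argmin F x -> is_derive x h F d -> d = 0.
Proof.
move=> Fmin Fd; apply/eqP; rewrite eq_le; apply/andP; split; last first.
  apply: (cvgr_to_ge (is_derive_cvg_at_right Fd)); near=> t.
  by rewrite mulr_ge0 ?subr_ge0 ?invr_ge0.
case: Fd => Fxh <-; apply: (cvgr_to_le (cvg_dnbhs_at_left Fxh)); near=> t.
by rewrite /= -[_ *: _]/(_ * _) mulr_le0_ge0 ?subr_ge0 ?invr_le0.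
Unshelve. all: by end_near. Qed.

Definition strongly_midconvex {V : normedModType R} (mu : R) (q : V -> R) :=
  forall a b,
    q (2^-1 *: (a + b)) + mu * `|a - b| ^+ 2 <= 2^-1 * (q a + q b).

(* Strong convexity turns any minimising sequence into a Cauchy sequence. *)
Lemma strongly_midconvex_argmin {V : completeNormedModType R} (mu : R)
    (q : V -> R) :
  0 < mu -> continuous q -> strongly_midconvex mu q -> has_lbound (range q) ->
  exists x, is_argmin q x.
Proof.
move=> mu_gt0 q_cont q_conv q_lb; set m := inf (range q).
have m_le x : m <= q x by apply: ge_inf => //; exists x.
have inf_q : has_inf (range q) by split => //; exists (q 0), 0.
have [v /choice[x_ x_v] v_cvg] : exists2 v : R^nat,
    (forall n, exists x, q x = v n) & v @ \oo --> m.
  have [v vq v_cvg] := inf_cvg_seq inf_q; exists v => // n.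
  by have [x _ <-] := vq n; exists x.
have {v v_cvg x_v} qx_cvg : q (x_ n) @[n --> \oo] --> m.
  by under eq_fun do rewrite x_v.
have dist_le i j : mu * `|x_ i - x_ j| ^+ 2
    <= 2^-1 * (q (x_ i) - m) + 2^-1 * (q (x_ j) - m).
  have := q_conv (x_ i) (x_ j); have := m_le (2^-1 *: (x_ i + x_ j)); lra.
have x_cvg : cvgn x_.
  apply/cauchy_cvgP/cauchy_exP => e e_gt0.
  have mue_gt0 : 0 < mu * e ^+ 2 by rewrite mulr_gt0 ?exprn_gt0.
  have [N _ small] : \forall n \near \oo, q (x_ n) - m < mu * e ^+ 2.
    move/cvgrPdist_lt/(_ _ mue_gt0): qx_cvg; apply: filterS => n.
    by rewrite /= distrC; apply: le_lt_trans; exact: ler_norm.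
  exists (x_ N); exists N => // n Nn; rewrite -ball_normE /=.
  rewrite -(@ltr_pXn2r _ 2) ?nnegrE ?(ltW e_gt0) // -(ltr_pM2l mu_gt0).
  by have := dist_le N n; have := small _ (leqnn N); have := small _ Nn; lra.
exists (limn x_) => u; suff -> : q (limn x_) = m by [].
apply: cvg_unique qx_cvg => //.
by apply: continuous_cvg; [exact: q_cont|exact: x_cvg].
Qed.

End Minimisers.

Lemma normZ_sqr {R : realType} {V : normedModType R} (a : R) (x : V) :
  `|a *: x| ^+ 2 = a ^+ 2 * `|x| ^+ 2.
Proof. by rewrite normrZ exprMn real_normK ?num_real. Qed.

Section RealSequences.
Context {R : realType}.

Lemma series0 (a : R^nat) : series a 0%N = 0.
Proof. by rewrite /series /= big_geq. Qed.

Lemma series_ge0 (a : R^nat) n : (forall k, 0 <= a k) -> 0 <= series a n.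
Proof. by move=> a_ge0; rewrite seriesEnat sumr_ge0. Qed.

Lemma seriesS_gt0 (a : R^nat) n : (forall k, 0 < a k) -> 0 < series a n.+1.
Proof.
by move=> a_gt0; rewrite seriesSr ltr_wpDl // series_ge0 // => k; exact: ltW.
Qed.

Section WeightedSeries.
Context {a F : R^nat}.
Hypothesis a_ge0 : forall k, 0 <= a k.
Hypothesis F_noninc : nonincreasing_seq F.
Hypothesis F_ge0 : forall k, 0 <= F k.
Hypothesis series_aF_cvg : cvgn (series (fun k => a k * F k.+1)).

Local Notation T := (series (fun k => a k * F k.+1)).

Lemma series_increment_mul_le m n : (m <= n)%N ->
  (series a n - series a m) * F n <= limn T - T m.
Proof.
move=> mn; apply: (@le_trans _ _ (T n - T m)).
  rewrite !sub_series_geq // mulr_suml; apply: ler_sum_nat => k /andP[_ kn].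
  by rewrite ler_wpM2l //; exact: F_noninc.
rewrite lerD2r nondecreasing_cvgn_le //.
by apply: nondecreasing_series => k _ _; rewrite mulr_ge0.
Qed.

Lemma nonincreasing_weighted_cvg0 : series a @ \oo --> +oo -> F @ \oo --> 0.
Proof.
move=> a_oo; have series_gt0 : \forall n \near \oo, 0 < series a n.
  by move/cvgryPgt: a_oo.
apply: (@squeeze_cvgr _ _ _ _ (cst 0) (fun n => (series a n)^-1 * limn T)).
- apply: filterS series_gt0 => n an_gt0; rewrite F_ge0 /= ler_pdivlMl //.
  by have := @series_increment_mul_le 0%N n isT; rewrite !series0 !subr0.
- exact: cvg_cst.
- by rewrite -(mul0r (limn T)); apply: cvgMl; exact: (gtr0_cvgV0 series_gt0).2.
Qed.

Lemma series_mul_nonincreasing_cvg0 : series a @ \oo --> +oo ->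
  (series a n * F n) @[n --> \oo] --> 0.
Proof.
move=> a_oo; apply/cvgrPdist_lt => e e_gt0.
have e2_gt0 : 0 < e / 2 by rewrite divr_gt0.
have [m _ tail_small] : \forall m \near \oo, `|limn T - T m| < e / 2.
  by move/cvgrPdist_lt: series_aF_cvg; apply.
have head_cvg0 : (series a m * F n) @[n --> \oo] --> 0.
  rewrite -(mulr0 (series a m)); apply: cvgMr.
  exact: nonincreasing_weighted_cvg0.
near=> n; rewrite sub0r normrN ger0_norm ?mulr_ge0 ?series_ge0 //.
have mn : (m <= n)%N by near: n; exact: nbhs_infty_ge.
have head_small : series a m * F n < e / 2.
  by near: n; exact: (cvgr_lt _ head_cvg0).
have := le_lt_trans (ler_norm _) (tail_small m (leqnn m)).
by have := series_increment_mul_le mn; lra.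
Unshelve. all: by end_near. Qed.

End WeightedSeries.

(* Convexity on the segment from [x] to [2 x]. *)
Lemma powR_addr_le (r x t : R) : 1 <= r -> 0 <= t <= x -> 0 < x ->
  (x + t) `^ r <= x `^ r + (2 `^ r - 1) * t * x `^ (r - 1).
Proof.
move=> r_ge1 /andP[t_ge0 tx] x_gt0; have x_ge0 := ltW x_gt0.
have r_gt0 : 0 < r by exact: lt_le_trans r_ge1.
have w_ge0 : 0 <= t / x by rewrite divr_ge0.
have w_le1 : t / x <= 1 by rewrite ler_pdivrMr // mul1r.
have -> : x `^ r + (2 `^ r - 1) * t * x `^ (r - 1) =
    t / x * (2 * x) `^ r + (1 - t / x) * x `^ r.
  by rewrite powRM // -(mulr_powRB1 x_ge0 r_gt0); field; rewrite gt_eqF.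
have -> : x + t = t / x * (2 * x) + (1 - t / x) * x by field; rewrite gt_eqF.
have := convex_powR r_ge1 (Itv01 w_ge0 w_le1) (x := 2 * x) (y := x).
rewrite !inE /= !in_itv /= !andbT mulr_ge0 // x_ge0 => /(_ isT isT).
by rewrite [X in X `^ _ <= _ -> _]convRE convRE.
Qed.

(* Discrete counterpart of [s' >= kappa s^(1 - 1/r)], whose solutions grow like
   the [r]-th power of time. *)
Lemma powR_recurrence_growth (s : R^nat) (kappa r : R) :
  1 <= r -> 0 < kappa -> 0 < s 0%N ->
  (forall n, s n + kappa * s n `^ (1 - r^-1) <= s n.+1) ->
  exists2 c, 0 < c & forall n, (c * n.+1%:R) `^ r <= s n.
Proof.
move=> r_ge1 kappa_gt0 s0_gt0 s_rec.
have r_gt0 : 0 < r by exact: lt_le_trans r_ge1.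
have rV_le1 : r^-1 <= 1 by rewrite invf_le1.
pose c := Num.min (s 0%N `^ r^-1) (kappa / 2 `^ r).
have c_gt0 : 0 < c by rewrite lt_min powR_gt0 // divr_gt0 // powR_gt0.
exists c => //; elim=> [|n IH].
  have -> : s 0%N = (s 0%N `^ r^-1) `^ r.
    by rewrite -powRrM mulVf ?powRr1 ?gt_eqF // ltW.
  rewrite mulr1 ge0_ler_powR ?nnegrE ?powR_ge0 ?(ltW r_gt0) ?(ltW c_gt0) //.
  by rewrite ge_min lexx.
have x_gt0 : 0 < c * n.+1%:R by rewrite mulr_gt0.
rewrite -[n.+2]addn1 natrD mulrDr mulr1.
apply: le_trans (powR_addr_le r_ge1 _ x_gt0) _.
  by rewrite (ltW c_gt0) -[leLHS]mulr1 ler_pM2l // ler1n.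
apply: le_trans (s_rec n); apply: lerD => //; apply: ler_pM.
- have : (2 : R) <= 2 `^ r by rewrite le1r_powR // ler1n.
  by move=> pow2_ge2; rewrite mulr_ge0 ?(ltW c_gt0) //; lra.
- exact: powR_ge0.
- have : 2 `^ r * c <= kappa.
    by rewrite mulrC -ler_pdivlMr ?powR_gt0 // ge_min lexx orbT.
  by have := ltW c_gt0; lra.
- have -> : r - 1 = r * (1 - r^-1) by field; rewrite gt_eqF.
  rewrite powRrM ge0_ler_powR ?nnegrE ?powR_ge0 ?subr_ge0 //.
  by rewrite (le_trans _ IH) ?powR_ge0.
Qed.

Lemma powR_root_le_addr (r x a b : R) : 1 <= r -> 0 <= x -> 0 < a ->
  (x / a) `^ (r - 1) <= b -> x `^ (1 - r^-1) <= a + b.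
Proof.
move=> r_ge1 x_ge0 a_gt0 xab; have r_gt0 : 0 < r by exact: lt_le_trans r_ge1.
have b_ge0 : 0 <= b by exact: le_trans (powR_ge0 _ _) xab.
have ab_ge0 : 0 <= a + b by rewrite addr_ge0 // ltW.
have -> : 1 - r^-1 = (r - 1) * r^-1 by field; rewrite gt_eqF.
have -> : a + b = ((a + b) `^ r) `^ r^-1.
  by rewrite -powRrM mulfV ?powRr1 ?gt_eqF.
rewrite powRrM.
rewrite ge0_ler_powR ?nnegrE ?powR_ge0 ?invr_ge0 ?(ltW r_gt0) //.
rewrite -(divfK (lt0r_neq0 a_gt0) x) powRM ?divr_ge0 ?(ltW a_gt0) //.
rewrite -(mulr_powRB1 ab_ge0 r_gt0); apply: ler_pM; rewrite ?powR_ge0 //.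
  by apply: le_trans xab _; rewrite lerDr ltW.
by rewrite ge0_ler_powR ?nnegrE ?subr_ge0 ?(ltW a_gt0) // lerDl.
Qed.

Lemma powR_growth_of_odd (s : R^nat) (c r : R) :
  0 < c -> 0 < r -> nondecreasing_seq s -> 0 <= s 0%N ->
  (forall j, (c * j.+1%:R) `^ r <= s j.*2.+1) ->
  forall n, (c / 2 * n%:R) `^ r <= s n.
Proof.
move=> c_gt0 r_gt0 s_nondec s0_ge0 s_odd [|n].
  by rewrite mulr0 powR0 ?gt_eqF.
apply: (@le_trans _ _ (s n./2.*2.+1)); last first.
  by apply: s_nondec; rewrite ltnS -[leqRHS]odd_double_half leq_addl.
apply: le_trans (s_odd _).
rewrite ge0_ler_powR ?(ltW r_gt0) ?nnegrE ?mulr_ge0 ?divr_ge0 ?(ltW c_gt0) //.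
rewrite -mulrA ler_pM2l // mulrC ler_pdivrMr // -natrM ler_nat.
by rewrite -{1}(odd_double_half n) -muln2; case: odd; lia.
Qed.

(* Two consecutive steps are merged, because the lower bound on [lam k.+1]
   degrades when [lam k] is large. *)
Lemma closed_loop_growth (lam : R^nat) (r D : R) :
  1 <= r -> 0 < D -> (forall k, 0 < lam k) ->
  (forall k, (series lam k.+1 / D / lam k) `^ (r - 1) <= lam k.+1) ->
  exists2 c, 0 < c & forall n, (c * n%:R) `^ r <= series lam n.
Proof.
move=> r_ge1 D_gt0 lam_gt0 feedback; set S := series lam.
have r_gt0 : 0 < r by exact: lt_le_trans r_ge1.
have S_nondec : nondecreasing_seq S.
  by apply: nondecreasing_series => k _ _; exact: ltW.
have S_ge0 n : 0 <= S n by rewrite series_ge0 // => k; exact: ltW.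
have [|||c c_gt0 S_odd] :=
    @powR_recurrence_growth (fun j => S j.*2.+1) (D^-1 `^ (1 - r^-1)) r r_ge1.
- by rewrite powR_gt0 ?invr_gt0.
- exact: seriesS_gt0.
- move=> j; rewrite doubleS /S (seriesSr lam j.*2.+2) (seriesSr lam j.*2.+1).
  rewrite -addrA lerD2l -powRM ?invr_ge0 ?(ltW D_gt0) // mulrC.
  apply: powR_root_le_addr => //.
    by rewrite divr_ge0 // ltW.
  apply: le_trans (feedback _).
  rewrite ge0_ler_powR ?subr_ge0 ?nnegrE ?divr_ge0 ?(ltW D_gt0)
    ?(ltW (lam_gt0 _)) //.
  by rewrite !ler_pM2r ?invr_gt0 //; exact: S_nondec.
exists (c / 2); first by rewrite divr_gt0.
exact: powR_growth_of_odd S_odd.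
Qed.

Lemma powR_growth_cvgy (s : R^nat) (c r : R) :
  0 < c -> 1 <= r -> (forall n, (c * n%:R) `^ r <= s n) -> s @ \oo --> +oo.
Proof.
move=> c_gt0 r_ge1 s_ge; apply/cvgryPge => A; near=> n.
have : Num.max 1 A <= c * n%:R.
  by rewrite -ler_pdivrMl //; near: n; exact: nbhs_infty_ger.
rewrite ge_max => /andP[cn1 An]; apply: le_trans (s_ge n).
by apply: le_trans An _; exact: le1r_powR.
Unshelve. all: by end_near. Qed.

Lemma littleo_powRN (s E : R^nat) (c r : R) :
  0 < c -> (forall n, (c * n%:R) `^ r <= s n) -> (forall n, 0 <= E n) ->
  (s n * E n) @[n --> \oo] --> 0 -> E =o_\oo (fun n => n%:R `^ (- r)).
Proof.
move=> c_gt0 s_ge E_ge0 sE_cvg0; apply/eqoP => e e_gt0.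
have ecr_gt0 : 0 < e * c `^ r by rewrite mulr_gt0 ?powR_gt0.
near=> n; have n_gt0 : 0 < (n%:R : R).
  by rewrite ltr0n; near: n; exact: nbhs_infty_gt.
rewrite ger0_norm // powRN ger0_norm ?invr_ge0 ?powR_ge0 //.
rewrite ler_pdivlMr ?powR_gt0 // -(ler_pM2l (powR_gt0 r c_gt0)) [leRHS]mulrC.
apply: (@le_trans _ _ (s n * E n)); last first.
  by near: n; exact: (cvgr_le _ sE_cvg0).
by rewrite mulrCA -powRM ?(ltW c_gt0) // mulrC ler_wpM2r.
Unshelve. all: by end_near. Qed.

End RealSequences.

Definition weak_cvg {R : realType} {V : normedModType R}
    (inner : V -> V -> R) {T : Type} (F : set_system T) (u : T -> V) (x : V) :=
  forall z, inner (u t) z @[t --> F] --> inner x z.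

Definition closed_loop_step {R : realType} {V : normedModType R}
    (y : nat -> V) (q : R) : R^nat :=
  fun k => `|y k.+1 - y k| `^ (- q).

Section HilbertSpace.
Context {R : realType} {V : completeNormedModType R} {inner : V -> V -> R}.
Hypothesis hilbert : hilbert_inner inner.

Lemma innerC x y : inner x y = inner y x.
Proof. by case: hilbert. Qed.

Lemma innerDl x y z : inner (x + y) z = inner x z + inner y z.
Proof. by case: hilbert. Qed.

Lemma innerZl (a : R) x y : inner (a *: x) y = a * inner x y.
Proof. by case: hilbert. Qed.

Lemma inner_sqr x : inner x x = `|x| ^+ 2.
Proof. by case: hilbert. Qed.

Lemma innerNl x y : inner (- x) y = - inner x y.
Proof. by rewrite -scaleN1r innerZl mulN1r. Qed.

Lemma innerBl x y z : inner (x - y) z = inner x z - inner y z.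
Proof. by rewrite innerDl innerNl. Qed.

Lemma innerDr x y z : inner z (x + y) = inner z x + inner z y.
Proof. by rewrite ![inner z _]innerC innerDl. Qed.

Lemma innerZr (a : R) x y : inner x (a *: y) = a * inner x y.
Proof. by rewrite ![inner x _]innerC innerZl. Qed.

Lemma innerNr x y : inner x (- y) = - inner x y.
Proof. by rewrite ![inner x _]innerC innerNl. Qed.

Lemma innerBr x y z : inner z (x - y) = inner z x - inner z y.
Proof. by rewrite ![inner z _]innerC innerBl. Qed.

Lemma inner_eq0 x : inner x x = 0 -> x = 0.
Proof. by rewrite inner_sqr => /eqP; rewrite sqrf_eq0 normr_eq0 => /eqP. Qed.

Lemma normD_sqr x y : `|x + y| ^+ 2 = `|x| ^+ 2 + 2 * inner x y + `|y| ^+ 2.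
Proof. by rewrite -!inner_sqr innerDl !innerDr (innerC y x); ring. Qed.

Lemma normB_sqr x y : `|x - y| ^+ 2 = `|x| ^+ 2 - 2 * inner x y + `|y| ^+ 2.
Proof. by rewrite normD_sqr innerNr normrN; ring. Qed.

(* The norm is already known to be subadditive, so squaring the triangle
   inequality is enough. *)
Lemma inner_le_norm x y : inner x y <= `|x| * `|y|.
Proof.
have : `|x + y| ^+ 2 <= (`|x| + `|y|) ^+ 2.
  by rewrite lerXn2r ?nnegrE ?addr_ge0 ?ler_normD.
rewrite normD_sqr; nra.
Qed.

Lemma Cauchy_Schwarz x y : `|inner x y| <= `|x| * `|y|.
Proof.
rewrite ler_norml inner_le_norm andbT lerNl -innerNl -(normrN x).
exact: inner_le_norm.
Qed.

Lemma is_derive_sqr_dist (a x h : V) :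
  is_derive x h (fun v => `|v - a| ^+ 2) (2 * inner (x - a) h).
Proof.
have quotient_cvg : t^-1 * (`|(t *: h + x) - a| ^+ 2 - `|x - a| ^+ 2)
    @[t --> 0^'] --> 2 * inner (x - a) h.
  have cvg_affine : 2 * inner (x - a) h + t * `|h| ^+ 2 @[t --> (0 : R)^']
      --> 2 * inner (x - a) h + 0 * `|h| ^+ 2.
    apply: cvgD; first exact: cvg_cst.
    by apply: cvgMl; exact: cvg_within.
  rewrite mul0r addr0 in cvg_affine; apply: cvg_trans cvg_affine.
  apply: near_eq_cvg; near=> t.
  have t0 : t != 0 by near: t; exact: nbhs_dnbhs_neq.
  rewrite -addrA [t *: h + _]addrC normD_sqr innerZr normZ_sqr.
  by field.
by split; [apply/cvg_ex; exists (2 * inner (x - a) h)|exact: cvg_lim].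
Unshelve. all: by end_near. Qed.

Lemma Riesz_representation (l : {linear V -> R^o}) : continuous l ->
  exists x, forall z, l z = inner x z.
Proof.
move=> l_cont; pose q x : R := `|x - 0| ^+ 2 - 2 * l x.
have q_cont : continuous q.
  move=> x; apply: cvgB; last by apply: cvgMr; exact: l_cont.
  by apply: cvgM; apply: cvg_norm; apply: cvgB => //; exact: cvg_cst.
have q_conv : strongly_midconvex 4^-1 q.
  move=> a b; have l_mid : l (2^-1 *: (a + b)) = 2^-1 * (l a + l b).
    by rewrite linearZ linearD.
  by rewrite /q !subr0 normZ_sqr normD_sqr normB_sqr l_mid; lra.
have q_lb : has_lbound (range q).
  have /linear_boundedP/pinfty_ex_gt0[M _ lM] :=
    (linear_bounded_continuous l).2 l_cont.
  exists (- M ^+ 2) => _ [x _ <-]; rewrite /q subr0.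
  have := le_trans (ler_norm _) (lM x); have := sqr_ge0 (`|x| - M); nra.
have [|x q_min] := strongly_midconvex_argmin _ q_cont q_conv q_lb.
  by rewrite invr_gt0.
exists x => z; have l_deriv : is_derive x z l (l z).
  have l_diff : differentiable l x by exact: linear_differentiable.
  by split; [exact: diff_derivable|rewrite deriveE // diff_lin].
have := is_derive_argmin_eq0 q_min
  (is_deriveB (is_derive_sqr_dist 0 x z) (is_deriveZ 2 l_deriv)).
by rewrite subr0 /GRing.scale /=; lra.
Qed.

Lemma bounded_ultra_weak_cvg {T : Type} (U : set_system T) (u : T -> V)
    (M : R) :
  UltraFilter U -> (forall t, `|u t| <= M) -> exists x, weak_cvg inner U u x.
Proof.
move=> UU uM; have PU : ProperFilter U by exact: ultra_proper.
have inner_bound z t : `|inner (u t) z| <= M * `|z|.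
  by apply: le_trans (Cauchy_Schwarz _ _) _; rewrite ler_wpM2r.
pose l z : R^o := lim (inner (u t) z @[t --> U]).
have l_cvg z : inner (u t) z @[t --> U] --> l z.
  exact: bounded_ultra_cvg (inner_bound z).
have l_linear : linear l.
  move=> a x y; apply: cvg_lim => //.
  under eq_fun do rewrite innerDr innerZr.
  by apply: cvgD => //; exact: cvgMr.
pose L : {linear V -> R^o} :=
  HB.pack l (GRing.isLinear.Build _ _ _ _ l l_linear).
have [|x xP] := @Riesz_representation L; last first.
  by exists x => z; rewrite -xP; exact: l_cvg.
apply/bounded_linear_continuous/linear_boundedP; near=> r => x.
apply: (@le_trans _ _ (M * `|x|)).
  by apply: (cvgr_to_le (cvg_norm (l_cvg x))); exact: nearW (inner_bound x).
by rewrite ler_wpM2r.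
Unshelve. all: by end_near. Qed.

Lemma cvg_inner_subr {T : Type} (F : set_system T) (u : T -> V) a b :
  Filter F -> cvg (`|u t - a| @[t --> F]) -> cvg (`|u t - b| @[t --> F]) ->
  cvg (inner (u t) (a - b) @[t --> F]).
Proof.
move=> FF ca cb.
have polarization t : inner (u t) (a - b) =
    2^-1 * (`|u t - b| ^+ 2 - `|u t - a| ^+ 2 - (`|b| ^+ 2 - `|a| ^+ 2)).
  by rewrite innerBr !normB_sqr; field.
apply/cvg_ex; eexists; under eq_fun do rewrite polarization.
apply: cvgMr; apply: cvgB; last exact: cvg_cst.
by apply: cvgB; apply: cvgM; [exact: cb|exact: cb|exact: ca|exact: ca].
Qed.

Lemma weak_cluster_unique {T : Type} (F G H : set_system T) (u : T -> V) a b :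
  ProperFilter G -> ProperFilter H -> F `<=` G -> F `<=` H ->
  cvg (inner (u t) (a - b) @[t --> F]) ->
  weak_cvg inner G u a -> weak_cvg inner H u b -> a = b.
Proof.
move=> PG PH FG FH /cvg_ex[/= c uc] ua ub.
have ac : inner a (a - b) = c.
  by apply: (cvg_unique _ (ua (a - b))) => //; apply: cvg_trans uc => A /FG.
have bc : inner b (a - b) = c.
  by apply: (cvg_unique _ (ub (a - b))) => //; apply: cvg_trans uc => A /FH.
by apply/subr0_eq/inner_eq0; rewrite innerBl ac bc subrr.
Qed.

Lemma Opial {T : Type} (F : set_system T) (S : set V) (u : T -> V) (M : R) :
  ProperFilter F -> (forall t, `|u t| <= M) ->
  (forall s, S s -> cvg (`|u t - s| @[t --> F])) ->
  (forall (U : set_system T) x,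
     UltraFilter U -> F `<=` U -> weak_cvg inner U u x -> S x) ->
  exists2 x, S x & weak_cvg inner F u x.
Proof.
move=> PF uM cvg_dist clusterS.
have [U [UU FU]] := ultraFilterLemma PF.
have [x ux] := bounded_ultra_weak_cvg UU uM.
have Sx : S x by exact: clusterS ux.
exists x => // z B Bx; rewrite /nbhs /=; apply/filter_ultraP => G UG FG.
have [y uy] := bounded_ultra_weak_cvg UG uM.
have Sy : S y by exact: clusterS uy.
have xy : x = y.
  apply: (weak_cluster_unique _ _ FU FG _ ux uy).
  by apply: cvg_inner_subr; exact: cvg_dist.
by apply: uy; rewrite -xy.
Qed.

Section ConvexFunction.
Context {f : V -> R} {g : V -> V}.
Hypothesis f_grad : is_gradient inner f g.

Lemma is_derive_gradient x h : is_derive x h f (inner (g x) h).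
Proof.
have [f_diff f_dir] := f_grad x.
by split; [exact: diff_derivable|rewrite deriveE].
Qed.

Lemma prox_gradient (lam : R) y u :
  0 < lam -> is_prox lam f y u -> lam *: g u = y - u.
Proof.
move=> lam_gt0 u_prox; set w := lam *: g u - (y - u).
have := is_derive_argmin_eq0 u_prox (is_deriveD (is_derive_gradient u w)
  (is_deriveZ (2 * lam)^-1 (is_derive_sqr_dist y u w))).
rewrite /GRing.scale /= => stationary.
apply/subr0_eq/inner_eq0; rewrite -/w {1}/w opprB innerDl innerZl.
by rewrite -[RHS](mulr0 lam) -stationary; field; rewrite gt_eqF.
Qed.

Hypothesis f_convex : convex_fun f.

Lemma convex_gradient_le x u : f u + inner (g u) (x - u) <= f x.
Proof.
rewrite -lerBrDl.
apply: (cvgr_to_le (is_derive_cvg_at_right (is_derive_gradient u (x - u)))).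
near=> t; have t_gt0 : 0 < t by near: t; exact: nbhs_right_gt.
have t_le1 : t <= 1 by near: t; exact: nbhs_right_le.
have -> : t *: (x - u) + u = t *: x + (1 - t) *: u.
  by rewrite scalerBl scale1r scalerBr [u - _]addrC addrA.
rewrite ler_pdivrMl //; have := @f_convex x u t.
by rewrite (ltW t_gt0) t_le1 => /(_ isT); lra.
Unshelve. all: by end_near. Qed.

Lemma convex_weak_lsc {T : Type} (F : set_system T) (u : T -> V) x l :
  ProperFilter F -> weak_cvg inner F u x -> f (u t) @[t --> F] --> l ->
  f x <= l.
Proof.
move=> PF ux fu_cvg.
have affine_cvg : f (u t) - inner (g x) (u t - x) @[t --> F]
    --> l - (inner x (g x) - inner x (g x)).
  apply: cvgB => //; under eq_fun do rewrite innerC innerBl.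
  by apply: cvgB; [exact: ux|exact: cvg_cst].
rewrite subrr subr0 in affine_cvg; apply: (cvgr_to_ge affine_cvg).
by apply: nearW => t; rewrite lerBrDr; exact: convex_gradient_le.
Qed.

Section ProximalStep.
Context {lam : R} {y u : V}.
Hypothesis lam_gt0 : 0 < lam.
Hypothesis u_prox : is_prox lam f y u.

Lemma prox_descent : lam * `|g u| ^+ 2 <= f y - f u.
Proof.
have := convex_gradient_le y u.
by rewrite -(prox_gradient lam_gt0 u_prox) innerZr inner_sqr; lra.
Qed.

Lemma prox_value_le : f u <= f y.
Proof.
rewrite -subr_ge0; apply: le_trans prox_descent.
by rewrite mulr_ge0 ?sqr_ge0 // ltW.
Qed.

(* Monotonicity of the gradient between [y] and [u]. *)
Lemma prox_gradient_norm_le : `|g u| <= `|g y|.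
Proof.
have := convex_gradient_le y u; have := convex_gradient_le u y.
rewrite -(opprB y) -(prox_gradient lam_gt0 u_prox) innerNr !innerZr.
rewrite inner_sqr => yu uy.
have {yu uy} : lam * `|g u| ^+ 2 <= lam * inner (g y) (g u) by lra.
rewrite ler_pM2l // => /le_trans/(_ (inner_le_norm _ _)).
have [->|gu0] := eqVneq (g u) 0; first by rewrite normr0.
by rewrite expr2 ler_pM2r ?normr_gt0.
Qed.

Lemma prox_fejer x :
  2 * lam * (f u - f x) + lam ^+ 2 * `|g u| ^+ 2
    <= `|y - x| ^+ 2 - `|u - x| ^+ 2.
Proof.
have subgradient := convex_gradient_le x u.
have -> : y - x = lam *: g u - (x - u).
  by rewrite (prox_gradient lam_gt0 u_prox) opprB addrA subrK.
rewrite normB_sqr innerZl normZ_sqr [`|u - x|]distrC.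
by have := lam_gt0; nra.
Qed.

Lemma prox_dist_argmin_le x : is_argmin f x -> `|u - x| <= `|y - x|.
Proof.
move=> x_min; rewrite -(@ler_pXn2r _ 2) ?nnegrE // -subr_ge0.
apply: le_trans (prox_fejer x).
by rewrite addr_ge0 ?mulr_ge0 ?sqr_ge0 ?subr_ge0 // ltW.
Qed.

End ProximalStep.

Section ProximalPointAlgorithm.
Context {Y : nat -> V} {lam : R^nat} {x : V}.
Hypothesis lam_gt0 : forall k, 0 < lam k.
Hypothesis Y_prox : forall k, is_prox (lam k) f (Y k) (Y k.+1).
Hypothesis x_min : is_argmin f x.

Let lam_ge0 k : 0 <= lam k. Proof. exact: ltW. Qed.

Let gap_ge0 n : 0 <= f (Y n) - f x. Proof. by rewrite subr_ge0. Qed.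

Lemma prox_lyapunov n :
  2 * series lam n * (f (Y n) - f x) + `|Y n - x| ^+ 2
    + series lam n ^+ 2 * `|g (Y n)| ^+ 2 <= `|Y 0%N - x| ^+ 2.
Proof.
elim: n => [|n]; first by rewrite series0; lra.
apply: le_trans; rewrite seriesSr.
have : 0 <= series lam n by exact: series_ge0.
move: (series lam n) => s s_ge0.
have gradient_le : s ^+ 2 * `|g (Y n.+1)| ^+ 2 <= s ^+ 2 * `|g (Y n)| ^+ 2.
  rewrite ler_wpM2l ?sqr_ge0 // lerXn2r ?nnegrE //.
  exact: prox_gradient_norm_le (Y_prox n).
have descent := ler_wpM2l s_ge0 (prox_descent (lam_gt0 n) (Y_prox n)).
have := prox_fejer (lam_gt0 n) (Y_prox n) x.
lra.
Qed.

Lemma prox_gradient_rate n : series lam n * `|g (Y n)| <= `|Y 0%N - x|.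
Proof.
have s_ge0 : 0 <= series lam n by exact: series_ge0.
rewrite -(@ler_pXn2r _ 2) ?nnegrE ?mulr_ge0 // exprMn.
apply: le_trans (prox_lyapunov n); rewrite lerDr.
by rewrite addr_ge0 ?mulr_ge0 ?sqr_ge0.
Qed.

Lemma prox_gap_noninc : nonincreasing_seq (fun n => f (Y n) - f x).
Proof.
apply/nonincreasing_seqP => n; rewrite lerD2r.
exact: prox_value_le (Y_prox n).
Qed.

Lemma prox_dist_noninc z : is_argmin f z ->
  nonincreasing_seq (fun k => `|Y k - z|).
Proof.
move=> z_min; apply/nonincreasing_seqP => k.
exact: prox_dist_argmin_le (Y_prox k) _ z_min.
Qed.

Lemma prox_value_series_cvg :
  cvgn (series (fun k => lam k * (f (Y k.+1) - f x))).
Proof.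
have term_ge0 k : 0 <= lam k * (f (Y k.+1) - f x).
  exact: mulr_ge0.
apply: nondecreasing_is_cvgn; first by apply: nondecreasing_series => k _ _.
exists (`|Y 0%N - x| ^+ 2) => _ [n _ <-].
suff : series (fun k => lam k * (f (Y k.+1) - f x)) n
    <= `|Y 0%N - x| ^+ 2 - `|Y n - x| ^+ 2.
  by move=> /le_trans; apply; rewrite lerBlDr lerDl sqr_ge0.
elim: n => [|n IH]; first by rewrite series0 subrr.
rewrite seriesSr; have := prox_fejer (lam_gt0 n) (Y_prox n) x.
have := mulr_ge0 (sqr_ge0 (lam n)) (sqr_ge0 `|g (Y n.+1)|).
by have := term_ge0 n; lra.
Qed.

Hypothesis lam_oo : series lam @ \oo --> +oo.

Lemma prox_value_rate : (series lam n * (f (Y n) - f x)) @[n --> \oo] --> 0.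
Proof.
exact: series_mul_nonincreasing_cvg0 lam_ge0 prox_gap_noninc gap_ge0
  prox_value_series_cvg lam_oo.
Qed.

Lemma prox_value_cvg : f (Y n) @[n --> \oo] --> f x.
Proof.
apply/subr_cvg0; exact: nonincreasing_weighted_cvg0 lam_ge0 prox_gap_noninc
  gap_ge0 prox_value_series_cvg lam_oo.
Qed.

Lemma prox_weak_cvg : exists2 z, is_argmin f z & weak_cvg inner \oo Y z.
Proof.
have Y_bounded k : `|Y k| <= `|Y 0%N - x| + `|x|.
  rewrite -[Y k](subrK x); apply: le_trans (ler_normD _ _) _.
  by rewrite lerD2r; exact: (prox_dist_noninc x_min).
apply: (Opial _ Y_bounded) => [z z_min|U z UU oU Yz v].
  apply: nonincreasing_is_cvgn; first exact: prox_dist_noninc.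
  by exists 0 => _ [k _ <-].
have PU : ProperFilter U by exact: ultra_proper.
apply: le_trans (x_min v); apply: (convex_weak_lsc _ Yz).
by apply: cvg_trans prox_value_cvg => A /oU.
Qed.

End ProximalPointAlgorithm.

Section ClosedLoop.
Context {y : nat -> V} {r : R} {x : V}.
Hypothesis r_ge1 : 1 <= r.
Hypothesis x_min : is_argmin f x.
Hypothesis y_moves : y 1%N != y 0%N.
Hypothesis y_grad_neq0 : forall k, g (y k.+1) != 0.

Local Notation lam := (closed_loop_step y (r - 1)).

Hypothesis y_prox : forall k, is_prox (lam k) f (y k.+1) (y k.+2).

Lemma closed_loop_increment_gt0 k : 0 < `|y k.+1 - y k|.
Proof.
elim: k => [|k IH]; first by rewrite normr_gt0 subr_eq0.
have lam_gt0 : 0 < lam k by exact: powR_gt0.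
rewrite distrC -(prox_gradient lam_gt0 (y_prox k)) normrZ.
by rewrite mulr_gt0 ?normr_gt0 ?gt_eqF.
Qed.

Lemma closed_loop_step_gt0 k : 0 < lam k.
Proof. by rewrite powR_gt0 ?closed_loop_increment_gt0. Qed.

Lemma closed_loop_feedback k :
  (series lam k.+1 / (`|y 1%N - x| + 1) / lam k) `^ (r - 1) <= lam k.+1.
Proof.
have lam_gt0 := closed_loop_step_gt0.
have D_gt0 : 0 < `|y 1%N - x| + 1 by rewrite ltr_wpDl.
have incrementE : `|y k.+2 - y k.+1| = lam k * `|g (y k.+2)|.
  by rewrite distrC -(prox_gradient _ (y_prox k)) // normrZ gtr0_norm.
have -> : lam k.+1 = `|y k.+2 - y k.+1|^-1 `^ (r - 1).
  by rewrite /closed_loop_step -powR_inv1 // -powRrM mulN1r.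
have S_ge0 : 0 <= series lam k.+1 by rewrite series_ge0 // => i; exact: ltW.
rewrite ge0_ler_powR ?nnegrE ?invr_ge0 ?subr_ge0 ?divr_ge0 ?(ltW D_gt0)
  ?(ltW (lam_gt0 _)) //.
rewrite incrementE invfM mulrC ler_pM2l ?invr_gt0 //.
rewrite ler_pdivrMr // mulrC ler_pdivlMr ?normr_gt0 //.
apply: le_trans (prox_gradient_rate lam_gt0 y_prox x_min k.+1) _.
by rewrite lerDl.
Qed.

Lemma closed_loop_series_growth :
  exists2 c, 0 < c & forall n, (c * n%:R) `^ r <= series lam n.
Proof.
apply: closed_loop_growth r_ge1 _ closed_loop_step_gt0 closed_loop_feedback.
by rewrite ltr_wpDl.
Qed.

End ClosedLoop.
End ConvexFunction.
End HilbertSpace.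

(* Indexing: y 0 = y_{-1}, y (k.+1) = y_k. *)
Theorem mainTheorem13 (R : realType) (V : completeNormedModType R)
  (inner : V -> V -> R) (f : V -> R) (gradf : V -> V) (p : R) (y : nat -> V) :
  hilbert_inner inner ->
  convex_fun f ->
  is_gradient inner f gradf ->
  continuous gradf ->
  lipschitz_on_bounded gradf ->
  (exists xs : V, is_argmin f xs) ->
  1 <= p ->
  y 1 != y 0 ->
  (forall k, is_prox (`|y k.+1 - y k| `^ (- ((p - 1) / p))) f (y k.+1) (y k.+2)) ->
  (forall k, gradf (y k.+1) != 0) ->
  (fun k : nat => f (y k.+1) - inf (range f))
    =o_\oo (fun k : nat => k%:R `^ (- (2 - p^-1))) /\
  exists xs : V, is_argmin f xs /\
    forall z : V, (fun k => inner (y k) z) @ \oo --> inner xs z.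
Proof.
move=> hilbert f_convex f_grad _ _ [x x_min] p_ge1 y_moves y_prox y_grad_neq0.
have p_gt0 : 0 < p by exact: lt_le_trans p_ge1.
have pV_le1 : p^-1 <= 1 by rewrite invf_le1.
have exponentE : (p - 1) / p = 2 - p^-1 - 1 by field; rewrite gt_eqF.
rewrite exponentE in y_prox.
have r_ge1 : 1 <= 2 - p^-1 by lra.
have lam_gt0 := closed_loop_step_gt0 hilbert f_grad y_moves y_grad_neq0 y_prox.
have [c c_gt0 growth] := closed_loop_series_growth hilbert f_grad f_convex
  r_ge1 x_min y_moves y_grad_neq0 y_prox.
have lam_oo := powR_growth_cvgy c_gt0 r_ge1 growth.
split.
  rewrite (inf_range_argmin x_min).
  apply: littleo_powRN c_gt0 growth _ _ => [n|].
    by rewrite subr_ge0.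
  exact: (prox_value_rate hilbert f_grad f_convex lam_gt0 y_prox x_min lam_oo).
have [xs xs_min y_weak] :=
  prox_weak_cvg hilbert f_grad f_convex lam_gt0 y_prox x_min lam_oo.
by exists xs; split => // z; rewrite -cvg_shiftS; exact: y_weak.
Qed.
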